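(* There exists exactly one symmetric matrix $G_7\in\mathbb{R}^{4\times 4}$ with unit diagonal satisfying $$G_7c_7=0,\qquad d_{4,7}^\top G_7(e_0-e_1)=0,\qquad d_{5,7}^\top G_7(e_1-e_2)=0 .$$ This matrix $G_7$ is positive semidefinite of rank three, and satisfies $$d_{i,7}^\top G_7\bigl(e_{\iota(i)}-e_j\bigr)\geq 0\qquad(0\leq i\leq 7,\ 0\leq j\leq 3),$$ $$d_{i,7}^\top G_7e_{\iota(i)}\geq 0\qquad(0\leq i\leq 7),$$ $$w_7^\top G_7w_7=S_7 .$$ Moreover, $G_7d_{6,7}=G_7d_{7,7}=0$.
   Context: Let $t_0=1$, $t_{k+1}=\bigl(1+\sqrt{1+4t_k^2}\bigr)/2$, and $S_7=\sum_{k=0}^7t_k^2$. In $\mathbb{R}^{8}$ with standard basis $e_0,\dots,e_7$, define $p_0=r_0=0$ and, for $k\geq 0$ (as long as the basis vector $e_k$ exists and $k+1\le 7$), $$r_{k+1}=p_k-e_k,\qquad p_{k+1}=r_{k+1}+\frac{t_k-1}{t_{k+1}}(r_{k+1}-r_k).$$ Let $\iota(j)=0$ for $0\le j\leq 4$ and $\iota(j)=j-4$ for $5\le j\le 7$. Let $E_7\in\mathbb{R}^{8\times 4}$ be the matrix with $E_7^\top e_j=e_{\iota(j)}$ for $0\le j\le 7$, where on the right $e_0,e_1,e_2,e_3$ is the standard basis of $\mathbb{R}^4$. Define vectors in $\mathbb{R}^4$: $$w_7=E_7^\top(t_0,\ldots,t_7)^\top,\qquad d_{i,7}=w_7+E_7^\top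 p_i-e_{\iota(i)}\quad(0\le i\le 7),\qquad c_7=d_{7,7}.$$ In the claim, $e_0,\dots,e_3$ denote the standard basis vectors of $\mathbb{R}^4$. *)

(* Defs.v *)
From mathcomp Require Import all_boot all_order all_algebra.
From mathcomp Require Import reals.

Set Implicit Arguments.
Unset Strict Implicit.
Unset Printing Implicit Defensive.

Import Order.TTheory GRing.Theory Num.Theory.
Local Open Scope ring_scope.

Section Defs.
Variable R : realType.

Fixpoint t (k : nat) : R :=
  if k is k'.+1 then (1 + Num.sqrt (1 + 4 * t k' ^+ 2)) / 2 else 1.

Definition S7 : R := \sum_(k < 8) t k ^+ 2.

(* Indexed by nat so that it can be used in recursions; zero when n <= k. *)
Definition evec (n k : nat) : 'cV[R]_n := \col_i (i == k :> nat)%:R.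

(* The pair (p_k, r_k); only k <= 7 is used, where evec 8 k' is a basis vector. *)
Fixpoint pr (k : nat) : 'cV[R]_8 * 'cV[R]_8 :=
  if k is k'.+1 then
    let: (p, r) := pr k' in
    let r' := p - evec 8 k' in
    (r' + ((t k' - 1) / t k'.+1) *: (r' - r), r')
  else (0, 0).

Definition p (k : nat) : 'cV[R]_8 := (pr k).1.

Definition iota7 (j : nat) : nat := if (j <= 4)%N then 0%N else (j - 4)%N.

(* Row j of E7 is the transpose of e_(iota j), i.e. E7^T e_j = e_(iota j). *)
Definition E7 : 'M[R]_(8, 4) := \matrix_(j < 8) (evec 4 (iota7 j))^T.

Definition w7 : 'cV[R]_4 := E7^T *m \col_(k < 8) t k.

Definition d7 (i : nat) : 'cV[R]_4 := w7 + E7^T *m p i - evec 4 (iota7 i).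

Definition c7 : 'cV[R]_4 := d7 7.

Definition bform n (G : 'M[R]_n) (u v : 'cV[R]_n) : R := (u^T *m G *m v) 0 0.

Definition psdmx n (G : 'M[R]_n) : Prop :=
  G^T = G /\ forall x : 'cV[R]_n, 0 <= bform G x x.

Definition G7_conditions (G : 'M[R]_4) : Prop :=
  [/\ G^T = G /\ (forall i, G i i = 1),
      G *m c7 = 0,
      bform G (d7 4) (evec 4 0 - evec 4 1) = 0
    & bform G (d7 5) (evec 4 1 - evec 4 2) = 0].

End Defs.

(* Main.v *)
Require Import Defs.
From mathcomp Require Import all_boot all_order all_algebra.
From mathcomp Require Import reals.
From mathcomp Require Import ring lra.
Import Order.TTheory GRing.Theory Num.Theory.
Local Open Scope ring_scope.

(** Write [f k] for the image in dimension four of the k-th basis vector and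
    let [u_k = r_k + e_k - p_k], pushed to dimension four, be the momentum
    vector.  The recursion of the method becomes
    [u_(k+1) = (t_k - 1) / t_(k+1) * u_k + f (k+1)], and with it
    [d_i = d_(i+1) + u_(i+1)] and [d_7 = (t_7 - 1) u_7].  Everything about the
    [d_i] follows from these two identities.  In particular [d_6] and [d_7] are
    multiples of [y = u_7 = (y0, y1, y2, 1)], which must span the kernel of the
    matrix; modulo [y], [d_5] is a negative multiple of [e3] and [d_4] one of
    [e2 + rho e3], with [rho = t_7 (t_5 + t_6 - 1) / t_5 ^ 2].  For [i < 4],
    [d_i - d_4] is a nonnegative multiple of [e0].

    The conditions on a symmetric matrix [g] with unit diagonal thus say:
    [g y = 0], [g13 = g23 =: h], and [g02 - g12 + rho (g03 - h) = 0].  This is a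
    linear system for the five remaining entries.  Eliminating all of them but
    [h] leaves a single equation whose leading coefficient [den] is positive,
    hence existence and uniqueness ([entries_unique], [conditions_solmx]).

    The inequalities need little more than signs.  For [i = 4] and [i = 5]
    they reduce to [g <= 1] on the entries, [rho >= 1], [h <= 0], [g12 <= 0] and
    [g02 <= g12].  Positive semidefiniteness and the rank come from
    [g y = 0] with [y3 = 1]: any vector may be moved along [y] until its last
    coordinate vanishes, and the upper left block of order three is strictly
    diagonally dominant.  The few numerical facts are read off rational
    enclosures of the [t_k] ([entry_bounds]).

    Finally, [w^T g w = S] does not depend on numerics: with
    [Z_k = sum_(j < k) t_j f j] one has [t_k p_k - (t_k - 1) r_k = - Z_k], and
    together with [t_(k+1) ^ 2 - t_(k+1) = t_k ^ 2] this turns the expansion of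
    the square of [Z_8 = w] into a telescoping sum whose terms contain
    [d_k^T g (f k - f (k+1))], or [d_7^T g f 7] for the last one; all of them
    vanish ([sum_of_squares]). *)

(** * The bilinear form of a matrix *)

Section BilinearForm.
Variables (R : realType) (n : nat) (G : 'M[R]_n).
Implicit Types u v w : 'cV[R]_n.

Lemma bformDl u v w : bform G (u + v) w = bform G u w + bform G v w.
Proof. by rewrite /bform linearD /= !mulmxDl mxE. Qed.

Lemma bformDr u v w : bform G u (v + w) = bform G u v + bform G u w.
Proof. by rewrite /bform mulmxDr mxE. Qed.

Lemma bformZl a u v : bform G (a *: u) v = a * bform G u v.
Proof. by rewrite /bform linearZ /= -!scalemxAl mxE. Qed.

Lemma bformZr a u v : bform G u (a *: v) = a * bform G u v.
Proof. by rewrite /bform -scalemxAr mxE. Qed.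

Lemma bformNl u v : bform G (- u) v = - bform G u v.
Proof. by rewrite -scaleN1r bformZl mulN1r. Qed.

Lemma bformNr u v : bform G u (- v) = - bform G u v.
Proof. by rewrite -scaleN1r bformZr mulN1r. Qed.

Lemma bform_kerr u v : G *m v = 0 -> bform G u v = 0.
Proof. by move=> Gv; rewrite /bform -mulmxA Gv mulmx0 mxE. Qed.

Lemma bformC u v : G^T = G -> bform G u v = bform G v u.
Proof.
move=> Gsym; rewrite /bform -[in LHS](trmxK (u^T *m G *m v)) [LHS]mxE.
by rewrite !trmx_mul trmxK Gsym mulmxA.
Qed.

Lemma bform_kerl u v : G^T = G -> G *m u = 0 -> bform G u v = 0.
Proof. by move=> Gsym Gu; rewrite bformC // bform_kerr. Qed.

Lemma bform_evec (i j : 'I_n) : bform G (evec R n i) (evec R n j) = G i j.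
Proof.
have evecE (k : 'I_n) : evec R n k = delta_mx k 0.
  by apply/colP => l; rewrite !mxE eqxx andbT.
by rewrite !evecE /bform trmx_delta -rowE -colE !mxE.
Qed.

End BilinearForm.

Arguments bformC {R n G} u v.
Arguments bform_kerr {R n G} u v.
Arguments bform_kerl {R n G} u v.

Definition bformE :=
  (bformDl, bformDr, bformNl, bformNr, bformZl, bformZr).

(** * Matrices of order four with a kernel vector *)

Local Notation i0 := (@Ordinal 4 0 isT).
Local Notation i1 := (@Ordinal 4 1 isT).
Local Notation i2 := (@Ordinal 4 2 isT).
Local Notation i3 := (@Ordinal 4 3 isT).

Lemma sum4 (V : zmodType) (F : 'I_4 -> V) :
  \sum_i F i = F i0 + F i1 + F i2 + F i3.
Proof.
rewrite !big_ord_recl big_ord0 addr0 !addrA.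
by congr (F _ + F _ + F _ + F _); apply: val_inj.
Qed.

Lemma ord4P (Pr : 'I_4 -> Prop) :
  Pr i0 -> Pr i1 -> Pr i2 -> Pr i3 -> forall i, Pr i.
Proof.
move=> p0 p1 p2 p3 [[|[|[|[|//]]]] i4]; rewrite (bool_irrelevance i4 isT) //.
Qed.

Lemma mulmx_col4_eq0 (R : realType) (G : 'M[R]_4) (v : 'cV[R]_4) : G *m v = 0 <->
  forall i, G i i0 * v i0 0 + G i i1 * v i1 0 + G i i2 * v i2 0
            + G i i3 * v i3 0 = 0.
Proof.
split=> [Gv i|Gv]; last by apply/colP => i; rewrite !mxE sum4 Gv.
by move/colP/(_ i): Gv; rewrite !mxE sum4.
Qed.

Lemma scaled_eq0 (F : fieldType) (c c' u v : F) :
  c != 0 -> c' != 0 -> c * u = c' * v -> u = 0 <-> v = 0.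
Proof.
move=> c0 c'0 cE; split=> w0; [apply: (mulfI c'0)|apply: (mulfI c0)].
  by rewrite -cE w0 !mulr0.
by rewrite cE w0 !mulr0.
Qed.

Lemma cross_term_bound (F : realFieldType) (l g a b : F) :
  - l <= g <= l -> - (l * (a ^+ 2 + b ^+ 2)) <= 2 * g * a * b.
Proof.
move=> /andP[lg gl].
have := mulr_ge0 (_ : 0 <= l + g) (sqr_ge0 (a + b)).
have := mulr_ge0 (_ : 0 <= l - g) (sqr_ge0 (a - b)).
by move=> /(_ ltac:(lra)) + /(_ ltac:(lra)); lra.
Qed.

(** The bounds on the three entries bound the upper left block of order three
    below by a quarter of the identity; the fourth row and column are controlled
    by the kernel vector alone. *)
Section Psd.
Variables (R : realType) (G : 'M[R]_4) (y : 'cV[R]_4).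
Hypotheses (Gsym : G^T = G) (Gdiag : forall i, G i i = 1).
Hypotheses (Gy : G *m y = 0) (y3 : y i3 0 = 1).
Hypotheses (g01 : - (1 / 2) <= G i0 i1 <= 1 / 2).
Hypotheses (g02 : - (1 / 4) <= G i0 i2 <= 1 / 4).
Hypotheses (g12 : - (1 / 4) <= G i1 i2 <= 1 / 4).

(* The translate of [v] along the kernel whose last coordinate is zero. *)
Let reduce (v : 'cV[R]_4) := v - v i3 0 *: y.

Lemma bform_reduce v : bform G v v = bform G (reduce v) (reduce v).
Proof.
by rewrite /reduce !bformE !(bform_kerr _ y) // !(bform_kerl y) //; lra.
Qed.

Lemma bform_reduce_ge v :
  (reduce v i0 0 ^+ 2 + reduce v i1 0 ^+ 2 + reduce v i2 0 ^+ 2) / 4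
    <= bform G v v.
Proof.
rewrite bform_reduce; have : reduce v i3 0 = 0 by rewrite !mxE y3 mulr1 subrr.
move: (reduce v) => u u3.
have sym i j : G j i = G i j by rewrite -{1}Gsym mxE.
rewrite /bform !mxE sum4 u3 !mxE !sum4 !mxE u3 !Gdiag.
rewrite (sym i0 i1) (sym i0 i2) (sym i1 i2).
have := cross_term_bound _ _ _ (u i0 0) (u i1 0) g01.
have := cross_term_bound _ _ _ (u i0 0) (u i2 0) g02.
have := cross_term_bound _ _ _ (u i1 0) (u i2 0) g12.
have := sqr_ge0 (u i2 0).
move: (u i0 0) (u i1 0) (u i2 0) => a b c; lra.
Qed.

Lemma psd_of_block : psdmx G.
Proof.
split=> // v; apply: le_trans (bform_reduce_ge v).
by rewrite divr_ge0 ?addr_ge0 ?sqr_ge0.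
Qed.

(** The kernel is the line of [y]: a kernel vector has form value 0, so its
    reduction, on which the form is definite, vanishes. *)
Lemma rank_of_block : \rank G = 3%N.
Proof.
have ker_sub : (kermx G <= y^T)%MS.
  apply/rV_subP => v /sub_kermxP vG.
  have Gv : G *m v^T = 0 by rewrite -{1}Gsym -trmx_mul vG trmx0.
  have := bform_reduce_ge v^T; rewrite bform_kerr // => le0.
  have a0 := sqr_ge0 (reduce v^T i0 0); have b0 := sqr_ge0 (reduce v^T i1 0).
  have c0 := sqr_ge0 (reduce v^T i2 0).
  have : reduce v^T = 0.
    apply/colP; apply: ord4P; rewrite [RHS]mxE.
    - by apply/eqP; rewrite -sqrf_eq0; apply/eqP; lra.
    - by apply/eqP; rewrite -sqrf_eq0; apply/eqP; lra.
    - by apply/eqP; rewrite -sqrf_eq0; apply/eqP; lra.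
    - by rewrite !mxE y3 mulr1 subrr.
  move/eqP; rewrite subr_eq0 => /eqP vE.
  by rewrite -[v]trmxK vE linearZ /= scalemx_sub.
have sub_ker : (y^T <= kermx G)%MS.
  by apply/sub_kermxP; rewrite -{1}Gsym -trmx_mul Gy trmx0.
have y_neq0 : y^T != 0.
  apply/eqP => /matrixP/(_ 0 i3); rewrite !mxE y3.
  by apply/eqP; rewrite oner_eq0.
have := mxrank_ker G; have := rank_leq_row G.
have -> : \rank (kermx G) = 1%N.
  apply/eqP; rewrite eqn_leq (leq_trans (mxrankS ker_sub)) ?rank_leq_row //=.
  by rewrite (leq_trans _ (mxrankS sub_ker)) // rank_rV y_neq0.
by case: (\rank G) => [|[|[|[|[|]]]]].
Qed.
End Psd.

(** * The momentum vectors *)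

Section Momentum.
Variable R : realType.

Lemma t_gt0 k : 0 < t R k.
Proof.
case: k => [|k] /=; first exact: ltr01.
by have := sqrtr_ge0 (1 + 4 * t R k ^+ 2); lra.
Qed.

Lemma t_sqr k : t R k.+1 ^+ 2 - t R k.+1 = t R k ^+ 2.
Proof.
have := t_gt0 k; rewrite /=; set x := t R k => x0.
have x20 : 0 <= 1 + 4 * x ^+ 2 by nra.
have := sqr_sqrtr x20; set s := Num.sqrt _ => sE.
lra.
Qed.

Lemma t_ge1 k : 1 <= t R k.
Proof.
case: k => [|k]; first exact: lexx.
rewrite -subr_ge0 -(pmulr_rge0 _ (t_gt0 k.+1)).
by rewrite mulrBr mulr1 -expr2 t_sqr sqr_ge0.
Qed.

Lemma t_gt1 k : 1 < t R k.+1.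
Proof.
rewrite -subr_gt0 -(pmulr_rgt0 _ (t_gt0 k.+1)).
by rewrite mulrBr mulr1 -expr2 t_sqr exprn_gt0 // t_gt0.
Qed.

Lemma t_neq0 k : t R k != 0.
Proof. by rewrite gt_eqF // t_gt0. Qed.

Lemma t_sub1_neq0 k : t R k.+1 - 1 != 0.
Proof. by rewrite subr_eq0 gt_eqF // t_gt1. Qed.

(** Since [s * (s - 1)] is increasing for [s >= 1] and takes the value
    [t_k ^ 2] at [t_(k+1)], an enclosure propagates through rational
    inequalities, without evaluating a square root. *)
Lemma t_bounds k a b a' b' : 1 <= a' -> 1 <= b' -> 0 <= a ->
    a' * (a' - 1) <= a ^+ 2 -> b ^+ 2 <= b' * (b' - 1) ->
  a <= t R k <= b -> a' <= t R k.+1 <= b'.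
Proof.
move=> a'1 b'1 a0 ha hb /andP[ak kb].
have := t_sqr k; have := t_gt0 k; have := t_gt0 k.+1.
set x := t R k.+1 in ak kb *; set y := t R k in ak kb *.
move=> x0 y0 xy.
have x1 : 1 < x by nra.
by apply/andP; split; rewrite leNgt; apply/negP; nra.
Qed.

Definition fvec k := evec R 4 (iota7 k).
Definition p4 k := (E7 R)^T *m p R k.
Definition r4 k := (E7 R)^T *m (pr R k).2.
(** [mom k] is the image of [r_k - r_(k+1)]; written with [p_k] so that it also
    makes sense for the last index. *)
Definition mom k := r4 k + fvec k - p4 k.
Definition mcoef k := (t R k - 1) / t R k.+1.

Lemma E7_evec k : (k < 8)%N -> (E7 R)^T *m evec R 8 k = fvec k.
Proof.
move=> k8; apply/colP => i; rewrite !mxE (bigD1 (Ordinal k8)) //= big1.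
  by rewrite !mxE eqxx mulr1 addr0.
move=> j jk; rewrite [X in _ * X]mxE.
by have /negPf -> : j != k :> nat by []; rewrite mulr0.
Qed.

Lemma r4_S k : (k < 8)%N -> r4 k.+1 = p4 k - fvec k.
Proof.
move=> k8; rewrite -E7_evec // /p4 -mulmxBr /r4 /p /=.
by case: (pr R k).
Qed.

Lemma p4_S k : p4 k.+1 = r4 k.+1 + mcoef k *: (r4 k.+1 - r4 k).
Proof.
rewrite /p4 /r4 -mulmxBr scalemxAr -mulmxDr /p /=.
by case: (pr R k).
Qed.

Lemma mom_0 : mom 0 = fvec 0.
Proof. by rewrite /mom /r4 /p4 /p /= !mulmx0 add0r subr0. Qed.

Lemma mom_S k : (k < 8)%N -> mom k.+1 = mcoef k *: mom k + fvec k.+1.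
Proof.
move=> k8; rewrite /mom p4_S r4_S //.
by apply/colP => i; rewrite !mxE; ring.
Qed.

(** The combination [t_k p_k - (t_k - 1) r_k] is the classical auxiliary iterate
    of the accelerated gradient method: each step changes it by a plain
    gradient step of length [t_k]. *)
Lemma partial_sum k : (k <= 8)%N ->
  \sum_(j < k) t R j *: fvec j = (t R k - 1) *: r4 k - t R k *: p4 k.
Proof.
elim: k => [|k IH] k8.
  by rewrite big_ord0 /r4 /p4 /p /= !mulmx0 !scaler0 subrr.
rewrite big_ord_recr /= IH ?(ltnW k8)// p4_S r4_S // -/(t R k.+1).
have := t_gt0 k.+1; rewrite /mcoef; move: (t R k.+1) (p4 k) (r4 k) (fvec k).
move=> y v u e y0; apply/colP => i; rewrite !mxE.
by field; exact: lt0r_neq0.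
Qed.

Lemma w7_sum : w7 R = \sum_(j < 8) t R j *: fvec j.
Proof.
apply/colP => i; rewrite mxE summxE; apply: eq_bigr => j _.
by rewrite !mxE mulrC.
Qed.

Lemma d7_step i : (i < 8)%N -> d7 R i = d7 R i.+1 + mom i.+1.
Proof.
move=> i8; rewrite /d7 -!/(p4 _) -!/(fvec _) /mom r4_S //.
by apply/colP => j; rewrite !mxE; ring.
Qed.

(** By [partial_sum], [w] minus its last term cancels [t_7 p_7] against
    [(t_7 - 1) r_7]. *)
Lemma d7_last : d7 R 7 = (t R 7 - 1) *: mom 7.
Proof.
have w7E : w7 R = \sum_(j < 7) t R j *: fvec j + t R 7 *: fvec 7.
  by rewrite w7_sum big_ord_recr.
rewrite /d7 -/(p4 7) -/(fvec 7) w7E partial_sum // /mom.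
move: (t R 7) (p4 7) (r4 7) (fvec 7) => y v u e.
by apply/colP => j; rewrite !mxE; ring.
Qed.

(** The coordinates of [mom 7] on the first three basis vectors, the last one
    being 1; [krho] is the weight that [d7 4] puts on the last basis vector,
    relative to the third, once multiples of [mom 7] are discarded. *)
Definition ker2 : R := mcoef 6.
Definition ker1 : R := mcoef 5 * ker2.
Definition ker0 : R :=
  mcoef 4 * (mcoef 3 * (mcoef 2 * (mcoef 1 + 1) + 1) + 1) * ker1.
Definition krho : R := t R 7 * (t R 5 + t R 6 - 1) / t R 5 ^+ 2.

(** The increment of the square of [Z_k] is [2 t_k <Z_k, f k> + t_k ^ 2], and
    [t_k Z_k] is, by [partial_sum], up to multiples of [w] and [f k] a
    combination of [d_k] and [d_(k-1)] with weights [t_k ^ 2] and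
    [t_k ^ 2 - t_k = t_(k-1) ^ 2]; replacing [f k] by [f (k-1)] in the second
    product makes the sum telescope. *)
Lemma sum_of_squares (G : 'M[R]_4) : G^T = G -> (forall i, G i i = 1) ->
    (forall k, (k < 7)%N -> bform G (d7 R k) (fvec k - fvec k.+1) = 0) ->
    bform G (d7 R 7) (fvec 7) = 0 ->
  bform G (w7 R) (w7 R) = S7 R.
Proof.
move=> Gsym Gdiag step last.
have f1 k : (k < 8)%N -> bform G (fvec k) (fvec k) = 1.
  move=> k8; have i4 : (iota7 k < 4)%N by move: k k8; do 8!case=> //.
  by rewrite /fvec (bform_evec R 4 G (Ordinal i4) (Ordinal i4)) Gdiag.
pose Z k := \sum_(j < k) t R j *: fvec j.
have ZS k : Z k.+1 = Z k + t R k *: fvec k by rewrite /Z big_ord_recr.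
suff tele k : (k < 8)%N -> bform G (Z k.+1) (Z k.+1) =
    2 * bform G (w7 R) (Z k.+1) - \sum_(j < k.+1) t R j ^+ 2
    - 2 * t R k ^+ 2 * bform G (d7 R k) (fvec k).
  have := tele 7 isT; rewrite last -/(S7 R) /Z -w7_sum; lra.
elim: k => [|k IH] k8.
  rewrite ZS /Z big_ord0 add0r big_ord_recl big_ord0 /d7 -!/(p4 _) -!/(fvec _).
  rewrite /p4 /p /= mulmx0 !addr0 !bformE f1 //; lra.
(* [r_(k+1)] and [p_(k+1)] expressed through [d_k] and [d_(k+1)]. *)
have tz : t R k.+1 *: Z k.+1 =
  t R k ^+ 2 *: (d7 R k - w7 R) - t R k.+1 ^+ 2 *: (d7 R k.+1 - w7 R + fvec k.+1).
  rewrite /Z partial_sum ?(ltnW k8)// r4_S ?(ltnW k8)// -t_sqr.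
  rewrite /d7 -!/(p4 _) -!/(fvec _).
  move: (t R k.+1) (w7 R) (p4 k) (p4 k.+1) (fvec k) (fvec k.+1) => y w u u' e e'.
  by apply/colP => j; rewrite !mxE; ring.
have -> : \sum_(j < k.+2) t R j ^+ 2 =
          \sum_(j < k.+1) t R j ^+ 2 + t R k.+1 ^+ 2 by rewrite big_ord_recr.
have := congr1 (fun v => bform G v (fvec k.+1)) tz.
move: (step k k8) (IH (ltnW k8)); rewrite [Z k.+2]ZS -t_sqr.
move: (f1 k.+1 k8) (bformC (Z k.+1) (fvec k.+1) Gsym).
move: (t R k.+1) (w7 R) (d7 R k) (d7 R k.+1) (fvec k) (fvec k.+1) (Z k.+1).
move=> y w u u' e e' z; rewrite !bformE => -> <- ue -> zE.
suff : 2 * (y * bform G z e') = 2 * (y ^+ 2 - y) * bform G u e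
    - 2 * y ^+ 2 * bform G u' e' + 2 * y * bform G w e' - 2 * y ^+ 2 by lra.
rewrite zE (_ : bform G u e = bform G u e'); first by ring.
by apply/eqP; rewrite -subr_eq0 ue.
Qed.
End Momentum.

(** * The linear system for the entries *)

Section Reduced.
Variables (F : realFieldType) (y0 y1 y2 rho : F).

(** In terms of the entries, [entry3] is the common value [h] of the entries
    (1,3) and (2,3), [diff03] is the difference [g03 - h], and the system implies
    [y1 y2 g12 + (y1 + y2) h + kap = 0]; the numerators are arranged to
    limit the cancellation that an interval estimate suffers. *)
Definition kap := (1 + y1 ^+ 2 + y2 ^+ 2 - y0 ^+ 2) / 2.
Definition den := y1 * y2 * (1 + rho * (y0 + y1 + y2)) - (y0 + y1) * (y1 + y2).
Definition entry3 := ((y0 + y1) * kap - y1 * y2 * (y2 + rho)) / den.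
Definition gap := kap * (y0 + y1 + y2) - (y1 + y2).
Definition entry12 := ((y1 + y2) * y2 - kap - rho * gap) / den.
Definition diff03 :=
  (y1 * y2 * (y2 * (y0 + y1 + y2) - 1) - (y0 + y1) * gap) / (y0 * den).
Definition entry03 := entry3 + diff03.
Definition entry02 := entry12 - rho * diff03.
Definition entry01 := - (y1 + y2 * entry12 + entry3) / y0.

Lemma entries_unique g01 g02 g03 g12 h :
    y0 != 0 -> y1 != 0 -> y2 != 0 -> den != 0 ->
  [/\ y0 + y1 * g01 + y2 * g02 + g03 = 0, y0 * g01 + y1 + y2 * g12 + h = 0,
      y0 * g02 + y1 * g12 + y2 + h = 0, y0 * g03 + y1 * h + y2 * h + 1 = 0
    & g02 - g12 + rho * (g03 - h) = 0] <->
  [/\ g01 = entry01, g02 = entry02, g03 = entry03, g12 = entry12 & h = entry3].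
Proof.
move=> y0n y1n y2n dn; split; last first.
  move=> [-> -> -> -> ->].
  rewrite /entry01 /entry02 /entry03 /diff03 /entry12 /entry3 /gap.
  have y2n' : 2 != 0 :> F by rewrite pnatr_eq0.
  move: dn; rewrite /den => dn.
  by split; rewrite /kap; field; rewrite dn y0n.
move=> [e0 e1 e2 e3 e].
(* In Gram terms: [y0 g0 + g3] and [y1 g1 + y2 g2] are opposite, hence have the
   same length. *)
have k : y1 * y2 * g12 + (y1 + y2) * h + kap = 0.
  have := congr1 ( *%R y0) e0; have := congr1 ( *%R y1) e1.
  have := congr1 ( *%R y2) e2; rewrite /kap; clear -e3; lra.
(* The last equation times [- y0], with [g02] and [g03] eliminated. *)
have l : y2 + h + (y0 + y1) * g12 + rho * (1 + (y0 + y1 + y2) * h) = 0.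
  have := congr1 ( *%R rho) e3; have := congr1 ( *%R y0) e.
  clear -e2; lra.
have hE : h = entry3.
  apply: (mulIf dn); rewrite /entry3 divfK // /den.
  have := congr1 ( *%R (y1 * y2)) l; have := congr1 ( *%R (y0 + y1)) k.
  clear; lra.
have g12E : g12 = entry12.
  apply: (mulIf dn); rewrite /entry12 divfK // /den /gap.
  have := congr1 ( *%R (y1 + y2)) l.
  have := congr1 ( *%R (1 + rho * (y0 + y1 + y2))) k.
  clear; lra.
have g03E : g03 = entry03.
  apply: (mulfI y0n); transitivity (- (y1 * h + y2 * h + 1)).
    by clear -e3; lra.
  rewrite hE /entry03 /entry3 /diff03 /gap /kap; move: dn; rewrite /den => dn.
  have n2 : 2 != 0 :> F by rewrite pnatr_eq0.
  by field; rewrite dn y0n.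
split=> //.
  apply: (mulfI y0n); rewrite /entry01 -g12E -hE mulrCA divff // mulr1.
  by clear -e1; lra.
have diffE : diff03 = g03 - h by rewrite g03E hE /entry03 addrC addKr.
by rewrite /entry02 -g12E diffE; clear -e; lra.
Qed.

End Reduced.

Arguments kap {F}.
Arguments den {F}.
Arguments gap {F}.
Arguments diff03 {F}.
Arguments entry01 {F}.
Arguments entry02 {F}.
Arguments entry03 {F}.
Arguments entry12 {F}.
Arguments entry3 {F}.

(** * Numerical enclosures *)

Section Enclosures.
Variable R : realFieldType.
Implicit Types x y l u lo hi : R.

Lemma mul_bounds lo hi l u l' u' x y : 0 <= l -> 0 <= l' ->
    lo <= l * l' -> u * u' <= hi -> l <= x <= u -> l' <= y <= u' ->
  lo <= x * y <= hi.
Proof.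
move=> l0 l'0 hlo hhi /andP[lx xu] /andP[l'y yu'].
rewrite (le_trans hlo) ?ler_pM//= (le_trans _ hhi)// ler_pM//.
  exact: le_trans lx.
exact: le_trans l'y.
Qed.

Lemma div_bounds lo hi l u l' u' x y : 0 <= lo -> 0 <= hi -> 0 < l' ->
    lo * u' <= l -> u <= hi * l' -> l <= x <= u -> l' <= y <= u' ->
  lo <= x / y <= hi.
Proof.
move=> lo0 hi0 l'0 hlo hhi /andP[lx xu] /andP[l'y yu'].
have y_gt0 : 0 < y by apply: lt_le_trans l'y.
rewrite ler_pdivlMr // ler_pdivrMr //; apply/andP; split.
  by rewrite (le_trans _ lx)// (le_trans _ hlo)// ler_wpM2l.
by rewrite (le_trans xu)// (le_trans hhi)// ler_wpM2l.
Qed.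

End Enclosures.

Arguments mul_bounds {R lo hi l u l' u' x y}.
Arguments div_bounds {R lo hi l u l' u' x y}.

(** Interval arithmetic along the formulas for the entries.  The binding
    quantity is the numerator of [diff03], about 0.008 as a difference of terms
    near 0.03; it dictates the accuracy of about 0.0005 asked of the kernel
    coordinates. *)
Lemma entry_bounds (F : realFieldType) (y0 y1 y2 rho : F) :
    159 / 326 <= y0 <= 125 / 256 -> 120 / 269 <= y1 <= 104 / 233 ->
    515 / 749 <= y2 <= 185 / 269 -> 199 / 83 <= rho <= 554 / 231 ->
  0 < den y0 y1 y2 rho /\
  [/\ - (1 / 2) <= entry01 y0 y1 y2 rho <= 1 / 2,
      - (1 / 4) <= entry02 y0 y1 y2 rho <= entry12 y0 y1 y2 rho,
      - (1 / 4) <= entry12 y0 y1 y2 rho <= 0 & entry3 y0 y1 y2 rho <= 0].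
Proof.
move=> h0 h1 h2 hr.
have q : 23 / 75 <= y1 * y2 <= 35 / 114.
  by apply: mul_bounds h1 h2; clear; lra.
have s0 : 39 / 164 <= y0 * y0 <= 31 / 130.
  by apply: (mul_bounds _ _ _ _ h0 h0); clear; lra.
have s1 : 37 / 186 <= y1 * y1 <= 52 / 261.
  by apply: (mul_bounds _ _ _ _ h1 h1); clear; lra.
have s2 : 26 / 55 <= y2 * y2 <= 79 / 167.
  by apply: (mul_bounds _ _ _ _ h2 h2); clear; lra.
have kp : 91 / 127 <= kap y0 y1 y2 <= 104 / 145.
  by rewrite /kap !expr2; clear -s0 s1 s2; lra.
have P : 127 / 136 <= y0 + y1 <= 143 / 153 by clear -h0 h1; lra.
have S : 229 / 202 <= y1 + y2 <= 93 / 82 by clear -h1 h2; lra.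
have Y : 167 / 103 <= y0 + y1 + y2 <= 159 / 98 by clear -h0 h1 h2; lra.
have kY : 194 / 167 <= kap y0 y1 y2 * (y0 + y1 + y2) <= 199 / 171.
  by apply: mul_bounds kp Y; clear; lra.
have g : 3 / 109 <= gap y0 y1 y2 <= 5 / 166.
  by rewrite /gap; clear -kY S; lra.
have yY : 68 / 61 - 1 <= y2 * (y0 + y1 + y2) - 1 <= 183 / 164 - 1.
  by rewrite !lerD2r; apply: mul_bounds h2 Y; clear; lra.
have qyY : 7 / 199 <= y1 * y2 * (y2 * (y0 + y1 + y2) - 1) <= 9 / 253.
  by apply: mul_bounds q yY; clear; lra.
have Pg : 1 / 39 <= (y0 + y1) * gap y0 y1 y2 <= 2 / 71.
  by apply: mul_bounds P g; clear; lra.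
have T : 1 / 150 <= y1 * y2 * (y2 * (y0 + y1 + y2) - 1)
                    - (y0 + y1) * gap y0 y1 y2 <= 1 / 100.
  by clear -qyY Pg; lra.
have PS : 235 / 222 <= (y0 + y1) * (y1 + y2) <= 194 / 183.
  by apply: mul_bounds P S; clear; lra.
have rY : 1 + 276 / 71 <= 1 + rho * (y0 + y1 + y2) <= 1 + 393 / 101.
  by rewrite !lerD2l; apply: mul_bounds hr Y; clear; lra.
have qrY : 568 / 379 <= y1 * y2 * (1 + rho * (y0 + y1 + y2)) <= 431 / 287.
  by apply: mul_bounds q rY; clear; lra.
have d : 7 / 16 <= den y0 y1 y2 rho <= 4 / 9.
  by rewrite /den; clear -PS qrY; lra.
have Sy : 53 / 68 <= (y1 + y2) * y2 <= 39 / 50.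
  by apply: mul_bounds S h2; clear; lra.
have rg : 6 / 91 <= rho * gap y0 y1 y2 <= 6 / 83.
  by apply: mul_bounds hr g; clear; lra.
have Pk : 91 / 136 <= (y0 + y1) * kap y0 y1 y2 <= 59 / 88.
  by apply: mul_bounds P kp; clear; lra.
have yr : 515 / 749 + 199 / 83 <= y2 + rho <= 185 / 269 + 554 / 231.
  by clear -h2 hr; lra.
have qyr : 158 / 167 <= y1 * y2 * (y2 + rho) <= 271 / 286.
  by apply: mul_bounds q yr; clear; lra.
have e3 : 3 / 5 <= - entry3 y0 y1 y2 rho <= 13 / 20.
  have n3 :
    3 / 11 <= - ((y0 + y1) * kap y0 y1 y2 - y1 * y2 * (y2 + rho)) <= 7 / 25.
    by clear -Pk qyr; lra.
  by rewrite /entry3 -mulNr; apply: div_bounds n3 d; clear; lra.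
have e12 : 0 <= - entry12 y0 y1 y2 rho <= 1 / 36.
  have n12 :
    0 <= - ((y1 + y2) * y2 - kap y0 y1 y2 - rho * gap y0 y1 y2) <= 1 / 90.
    by clear -Sy rg kp; lra.
  by rewrite /entry12 -mulNr; apply: div_bounds n12 d; clear; lra.
have th : 0 <= diff03 y0 y1 y2 rho <= 1 / 20.
  have yd : 1 / 5 <= y0 * den y0 y1 y2 rho <= 1.
    by apply: mul_bounds h0 d; clear; lra.
  by apply: div_bounds T yd; clear; lra.
have rth : 0 <= rho * diff03 y0 y1 y2 rho <= 1 / 8.
  by apply: mul_bounds hr th; clear; lra.
have ye12 : 0 <= y2 * - entry12 y0 y1 y2 rho <= 1 / 50.
  by apply: mul_bounds h2 e12; clear; lra.
have e01 : 0 <= entry01 y0 y1 y2 rho <= 1 / 2.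
  have n01 :
    0 <= - (y1 + y2 * entry12 y0 y1 y2 rho + entry3 y0 y1 y2 rho) <= 6 / 25.
    by clear -h1 ye12 e3; lra.
  by apply: div_bounds n01 h0; clear; lra.
split; first by clear -d; lra.
by rewrite /entry02; split; [clear -e01|clear -rth e12|clear -e12|clear -e3]; lra.
Qed.

Section MomentumEnclosures.
Variable R : realType.

(** The endpoints are rationals of small height, accurate enough for
    [entry_bounds]. *)
Lemma t_enclosures :
  [/\ 377 / 233 <= t R 1 <= 233 / 144, 941 / 429 <= t R 2 <= 68 / 31,
      2219 / 807 <= t R 3 <= 3660 / 1331 & 313 / 95 <= t R 4 <= 715 / 217]
  /\ [/\ 709 / 185 <= t R 5 <= 939 / 245, 323 / 74 <= t R 6 <= 777 / 178
       & 964 / 197 <= t R 7 <= 783 / 160].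
Proof.
have t0 : 1 <= t R 0 <= 1 by rewrite /= lexx.
have t1 : 377 / 233 <= t R 1 <= 233 / 144 by apply: t_bounds t0; clear; lra.
have t2 : 941 / 429 <= t R 2 <= 68 / 31 by apply: t_bounds t1; clear; lra.
have t3 : 2219 / 807 <= t R 3 <= 3660 / 1331 by apply: t_bounds t2; clear; lra.
have t4 : 313 / 95 <= t R 4 <= 715 / 217 by apply: t_bounds t3; clear; lra.
have t5 : 709 / 185 <= t R 5 <= 939 / 245 by apply: t_bounds t4; clear; lra.
have t6 : 323 / 74 <= t R 6 <= 777 / 178 by apply: t_bounds t5; clear; lra.
by have t7 : 964 / 197 <= t R 7 <= 783 / 160 by apply: t_bounds t6; clear; lra.
Qed.

Lemma ker_enclosures :
  [/\ 159 / 326 <= ker0 R <= 125 / 256, 120 / 269 <= ker1 R <= 104 / 233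
    & 515 / 749 <= ker2 R <= 185 / 269].
Proof.
have [[t1 t2 t3 t4] [t5 t6 t7]] := t_enclosures.
have shift l u k : l <= t R k <= u -> l - 1 <= t R k - 1 <= u - 1.
  by rewrite !lerD2r.
have a1 : 71 / 252 <= mcoef R 1 <= 31 / 110.
  by apply: div_bounds (shift _ _ _ t1) t2; clear; lra.
have a2 : 148 / 341 <= mcoef R 2 <= 56 / 129.
  by apply: div_bounds (shift _ _ _ t2) t3; clear; lra.
have a3 : 137 / 258 <= mcoef R 3 <= 111 / 209.
  by apply: div_bounds (shift _ _ _ t3) t4; clear; lra.
have a4 : 91 / 152 <= mcoef R 4 <= 103 / 172.
  by apply: div_bounds (shift _ _ _ t4) t5; clear; lra.
have a5 : 85 / 131 <= mcoef R 5 <= 98 / 151.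
  by apply: div_bounds (shift _ _ _ t5) t6; clear; lra.
have ker2b : 515 / 749 <= ker2 R <= 185 / 269.
  by apply: div_bounds (shift _ _ _ t6) t7; clear; lra.
clear t1 t2 t3 t4 t5 t6 t7.
have s2 : 323 / 252 <= mcoef R 1 + 1 <= 141 / 110.
  by move: a1; clear; lra.
have s3 : 84 / 151 <= mcoef R 2 * (mcoef R 1 + 1) <= 69 / 124.
  by apply: mul_bounds a2 s2; clear; lra.
have {}s3 : 235 / 151 <= mcoef R 2 * (mcoef R 1 + 1) + 1 <= 193 / 124.
  by move: s3; clear; lra.
have s4 : 119 / 144 <= mcoef R 3 * (mcoef R 2 * (mcoef R 1 + 1) + 1) <= 62 / 75.
  by apply: mul_bounds a3 s3; clear; lra.
have {}s4 : 263 / 144 <= mcoef R 3 * (mcoef R 2 * (mcoef R 1 + 1) + 1) + 1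
                 <= 137 / 75.
  by move: s4; clear; lra.
have ker1b : 120 / 269 <= ker1 R <= 104 / 233.
  by apply: mul_bounds a5 ker2b; clear; lra.
have a4s4 : 199 / 182
              <= mcoef R 4 * (mcoef R 3 * (mcoef R 2 * (mcoef R 1 + 1) + 1) + 1)
              <= 198 / 181 by apply: mul_bounds a4 s4; clear; lra.
by split=> //; apply: mul_bounds a4s4 ker1b; clear; lra.
Qed.

Lemma krho_enclosure : 199 / 83 <= krho R <= 554 / 231.
Proof.
have [_ [t5 t6 t7]] := t_enclosures.
have s : 1058 / 147 <= t R 5 + t R 6 - 1 <= 1346 / 187.
  by move: t5 t6; clear; lra.
have num := mul_bounds _ _ (lexx _) (lexx _) t7 s.
have den := mul_bounds _ _ (lexx _) (lexx _) t5 t5.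
by rewrite /krho expr2; apply: div_bounds (num _ _) (den _ _); clear; lra.
Qed.
End MomentumEnclosures.

(** * The conditions in coordinates *)

Section Conditions.
Variable R : realType.
Local Notation e := (evec R 4).
Local Notation y0 := (ker0 R).
Local Notation y1 := (ker1 R).
Local Notation y2 := (ker2 R).
Local Notation rho := (krho R).

Lemma mom7E : mom R 7 = y0 *: e 0 + y1 *: e 1 + y2 *: e 2 + e 3.
Proof.
have a0 : mcoef R 0 = 0 by rewrite /mcoef subrr mul0r.
rewrite !mom_S // mom_0 a0 scale0r add0r /fvec [iota7 _]/= -!/(e _).
apply/colP => i; rewrite !mxE [iota7 _]/=.
rewrite /ker0 /ker1 /ker2.
move: (mcoef R 1) (mcoef R 2) (mcoef R 3) (mcoef R 4) (mcoef R 5) (mcoef R 6).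
by move=> *; ring.
Qed.

Lemma mom_low k : (k <= 4)%N -> exists2 s, 0 <= s & mom R k = s *: e 0.
Proof.
elim: k => [|k IH] k4; first by exists 1; rewrite ?ler01 // mom_0 scale1r.
have [s s0 xE] := IH (ltnW k4); exists (mcoef R k * s + 1).
  rewrite addr_ge0 // mulr_ge0 // divr_ge0 //; last exact: ltW (t_gt0 _ _).
  by rewrite subr_ge0 t_ge1.
rewrite mom_S ?(leq_trans k4) // xE scalerA scalerDl scale1r.
by rewrite /fvec /iota7 k4.
Qed.

Lemma d7_6 : d7 R 6 = t R 7 *: mom R 7.
Proof. by rewrite d7_step // d7_last scalerBl scale1r subrK. Qed.

Lemma scaled_mom_S k (i : 'I_4) : (k < 8)%N ->
  t R k.+1 * mom R k.+1 i 0 =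
    (t R k - 1) * mom R k i 0 + t R k.+1 * fvec R k.+1 i 0.
Proof.
move=> k8; rewrite mom_S // mxE [X in _ * (X + _)]mxE mulrDr mulrA /mcoef.
by rewrite mulrCA divff ?mulr1 // gt_eqF // t_gt0.
Qed.

Lemma d7_5 : (t R 6 - 1) *: d7 R 5 = t R 7 *: (t R 6 *: mom R 7 - e 3).
Proof.
rewrite (d7_step _ 5 isT) d7_6; apply/colP => i.
have := scaled_mom_S 6 i isT; rewrite -[evec R 4 3]/(fvec R 7).
move: (t R 6) (t R 7) (mom R 6) (mom R 7) (fvec R 7) => u v x6 x7 f7.
by rewrite !mxE; lra.
Qed.

(** Apply the momentum recursion twice, from [mom 5] to [mom 7]; up to sign,
    the weight of [e 2] comes out as [t_6 ^ 2 - t_6 = t_5 ^ 2]. *)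
Lemma d7_4 : (t R 5 - 1) *: ((t R 6 - 1) *: d7 R 4) =
  (t R 5 * t R 6 * t R 7) *: mom R 7 - t R 5 ^+ 2 *: (e 2 + rho *: e 3).
Proof.
have -> : t R 5 ^+ 2 *: (e 2 + rho *: e 3) =
    (t R 6 ^+ 2 - t R 6) *: e 2 + (t R 7 * (t R 5 + t R 6 - 1)) *: e 3.
  rewrite t_sqr scalerDr scalerA /krho mulrCA divff ?mulr1 //.
  by apply: expf_neq0; rewrite gt_eqF // t_gt0.
rewrite (d7_step _ 4 isT) scalerDr d7_5; apply/colP => i.
have := scaled_mom_S 6 i isT; have := scaled_mom_S 5 i isT.
rewrite -[evec R 4 3]/(fvec R 7) -[evec R 4 2]/(fvec R 6).
move: (t R 5) (t R 6) (t R 7) (mom R 5) (mom R 6) (mom R 7) (fvec R 6) (fvec R 7).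
move=> u v w x5 x6 x7 f6 f7; rewrite !mxE => h5 h6.
have := congr1 ( *%R (v - 1)) h5; have := congr1 ( *%R v) h6.
by clear; lra.
Qed.

Lemma mom7_entries : [/\ mom R 7 i0 0 = y0, mom R 7 i1 0 = y1, mom R 7 i2 0 = y2
  & mom R 7 i3 0 = 1].
Proof. by rewrite mom7E; split; rewrite !mxE /=; ring. Qed.

Lemma bform_d7_5 (G : 'M[R]_4) v : G^T = G -> G *m mom R 7 = 0 ->
  (t R 6 - 1) * bform G (d7 R 5) v = - t R 7 * bform G (e 3) v.
Proof.
move=> Gsym Gx; rewrite -bformZl d7_5.
move: (t R 6) (t R 7) (mom R 7) Gx => u w y Gy.
by rewrite !bformE (bform_kerl y) //; ring.
Qed.

Lemma bform_d7_4 (G : 'M[R]_4) v : G^T = G -> G *m mom R 7 = 0 ->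
  (t R 5 - 1) * ((t R 6 - 1) * bform G (d7 R 4) v)
    = - t R 5 ^+ 2 * (bform G (e 2) v + rho * bform G (e 3) v).
Proof.
move=> Gsym Gx; rewrite -!bformZl d7_4.
move: (t R 5) (t R 6) (t R 7) (mom R 7) Gx => u v' w y Gy.
by rewrite !bformE (bform_kerl y) //; ring.
Qed.

Lemma bform_e (G : 'M[R]_4) (i j : 'I_4) : bform G (e i) (e j) = G i j.
Proof. exact: bform_evec. Qed.

Lemma ker_den_neq0 :
  [/\ y0 != 0, y1 != 0, y2 != 0 & den y0 y1 y2 rho != 0].
Proof.
have [h0 h1 h2] := ker_enclosures R; have hr := krho_enclosure R.
have [d _] := entry_bounds _ _ _ _ _ h0 h1 h2 hr.
split; rewrite gt_eqF //; [clear -h0|clear -h1|clear -h2]; lra.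
Qed.

Lemma conditionsP (G : 'M[R]_4) : G7_conditions G <->
  [/\ G^T = G /\ (forall i, G i i = 1), G *m mom R 7 = 0, G i1 i3 = G i2 i3
    & G i0 i2 - G i1 i2 + rho * (G i0 i3 - G i1 i3) = 0].
Proof.
have c7E : G *m c7 R = (t R 7 - 1) *: (G *m mom R 7).
  by rewrite /c7 d7_last -scalemxAr.
have c7_0 : G *m c7 R = 0 <-> G *m mom R 7 = 0.
  rewrite c7E; split=> [/eqP|->]; last by rewrite scaler0.
  by rewrite scaler_eq0 (negPf (t_sub1_neq0 R 6)) => /eqP.
have sw (Gsym : G^T = G) i j : G j i = G i j by rewrite -{1}Gsym mxE.
have d5P : G^T = G -> G *m mom R 7 = 0 ->
    bform G (d7 R 5) (e 1 - e 2) = 0 <-> G i1 i3 = G i2 i3.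
  move=> Gsym Gx; have := bform_d7_5 G (e 1 - e 2) Gsym Gx.
  rewrite [bform G (e 3) _]bformDr bformNr (bform_e G i3 i1) (bform_e G i3 i2).
  rewrite (sw Gsym i1 i3) (sw Gsym i2 i3) => bE.
  have -> : G i1 i3 = G i2 i3 <-> G i1 i3 - G i2 i3 = 0.
    by split=> [->|/eqP]; rewrite ?subrr // subr_eq0 => /eqP.
  apply: scaled_eq0 bE.
  - exact: t_sub1_neq0.
  - by rewrite oppr_eq0; exact: t_neq0.
have d4P : G^T = G -> G *m mom R 7 = 0 -> bform G (d7 R 4) (e 0 - e 1) = 0 <->
    G i0 i2 - G i1 i2 + rho * (G i0 i3 - G i1 i3) = 0.
  move=> Gsym Gx; have := bform_d7_4 G (e 0 - e 1) Gsym Gx.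
  rewrite [bform G (e 3) _]bformDr [bform G (e 2) _]bformDr !bformNr.
  rewrite (bform_e G i3 i0) (bform_e G i3 i1) (bform_e G i2 i0) (bform_e G i2 i1).
  rewrite (sw Gsym i0 i3) (sw Gsym i1 i3) (sw Gsym i0 i2) (sw Gsym i1 i2).
  rewrite mulrA => bE; apply: scaled_eq0 bE.
    by apply: mulf_neq0; exact: t_sub1_neq0.
  by rewrite oppr_eq0; apply: expf_neq0; exact: t_neq0.
split=> [[[Gsym Gdiag] /c7_0 Gx d4 d5]|[[Gsym Gdiag] Gx g g']].
  by split=> //; [apply/d5P|apply/d4P].
by split=> //; [apply/c7_0|apply/d4P|apply/d5P].
Qed.

Definition solmx : 'M[R]_4 :=
  let g01 := entry01 y0 y1 y2 rho in let g02 := entry02 y0 y1 y2 rho in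
  let g03 := entry03 y0 y1 y2 rho in let g12 := entry12 y0 y1 y2 rho in
  let h := entry3 y0 y1 y2 rho in
  \matrix_(i, j) nth 0 (nth [::] [:: [:: 1; g01; g02; g03]; [:: g01; 1; g12; h];
    [:: g02; g12; 1; h]; [:: g03; h; h; 1]] i) j.

Lemma conditions_solmx (G : 'M[R]_4) : G7_conditions G <-> G = solmx.
Proof.
have [n0 n1 n2 nd] := ker_den_neq0; have [x0 x1 x2 x3] := mom7_entries.
split=> [/conditionsP[[Gsym Gdiag] /mulmx_col4_eq0 Gx g g']|->].
  have sw i j : G j i = G i j by rewrite -{1}Gsym mxE.
  have := entries_unique _ y0 y1 y2 rho (G i0 i1) (G i0 i2) (G i0 i3) (G i1 i2)
    (G i2 i3) n0 n1 n2 nd.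
  case=> + _; case.
    split; [move: (Gx i0)|move: (Gx i1)|move: (Gx i2)|move: (Gx i3)|move: g'];
    rewrite ?x0 ?x1 ?x2 ?x3 ?Gdiag ?(sw i0 i1) ?(sw i0 i2) ?(sw i0 i3)
      ?(sw i1 i2) ?(sw i1 i3) ?(sw i2 i3) ?g; clear; lra.
  move=> e01 e02 e03 e12 e23.
  apply/matrixP; do 2![apply: ord4P]; rewrite mxE /=
    ?Gdiag ?(sw i0 i1) ?(sw i0 i2) ?(sw i0 i3)
    ?(sw i1 i2) ?(sw i1 i3) ?(sw i2 i3) ?g //.
apply/conditionsP.
have := entries_unique _ y0 y1 y2 rho (solmx i0 i1) (solmx i0 i2) (solmx i0 i3)
  (solmx i1 i2) (solmx i2 i3) n0 n1 n2 nd.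
case=> _ []; first by split; rewrite mxE.
move=> r0 r1 r2 r3 r; split.
- split; last by apply: ord4P; rewrite mxE.
  by apply/matrixP; do 2![apply: ord4P]; rewrite !mxE.
- apply/mulmx_col4_eq0; rewrite x0 x1 x2 x3; apply: ord4P;
  [move: r0|move: r1|move: r2|move: r3]; rewrite !mxE /=; clear; lra.
- by rewrite !mxE.
- by rewrite -[RHS]r !mxE.
Qed.

(** Evaluate the form at [e i - e j]. *)
Lemma psd_entry_le1 (G : 'M[R]_4) : psdmx G -> (forall i, G i i = 1) ->
  forall i j, G i j <= 1.
Proof.
move=> [Gsym Gpos] Gdiag i j.
have := Gpos (e i - e j); rewrite !bformE !bform_e !Gdiag.
have -> : G j i = G i j by rewrite -{1}Gsym mxE.
by lra.
Qed.

(** All differences [d_k - d_(k+1) = mom (k+1)] with [k < 4] are nonnegative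
    multiples of [e 0]. *)
Lemma d7_low_ge0 (G : 'M[R]_4) v :
    0 <= bform G (d7 R 4) v -> 0 <= bform G (e 0) v ->
  forall k, (k <= 4)%N -> 0 <= bform G (d7 R k) v.
Proof.
move=> d4 e0 k k4; rewrite -(subKn k4).
elim: (4 - k)%N (leq_subr k 4) => // m IH m4.
have m4' : (4 - m.+1).+1 = (4 - m)%N by rewrite subnSK.
have [s s0 xE] := mom_low (4 - m) (leq_subr m 4).
rewrite d7_step; last by rewrite (leq_ltn_trans (leq_subr _ _)).
rewrite m4' xE bformDl bformZl addr_ge0 ?mulr_ge0 //.
exact: IH (ltnW m4).
Qed.

(** * Properties of the solution *)

Section Solution.
Variable G : 'M[R]_4.
Hypothesis GP : G7_conditions G.

Let Gsym : G^T = G. Proof. by have /conditionsP[[]] := GP. Qed.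
Let Gdiag i : G i i = 1. Proof. by have /conditionsP[[]] := GP. Qed.
Let Gx : G *m mom R 7 = 0. Proof. by have /conditionsP[] := GP. Qed.
Let G13 : G i1 i3 = G i2 i3. Proof. by have /conditionsP[] := GP. Qed.
Let Grel : G i0 i2 - G i1 i2 + rho * (G i0 i3 - G i1 i3) = 0.
Proof. by have /conditionsP[] := GP. Qed.
Let Gsw i j : G j i = G i j. Proof. by rewrite -{1}Gsym mxE. Qed.

Lemma solution_bounds :
  [/\ - (1 / 2) <= G i0 i1 <= 1 / 2, - (1 / 4) <= G i0 i2 <= G i1 i2,
      - (1 / 4) <= G i1 i2 <= 0 & G i2 i3 <= 0].
Proof.
have [h0 h1 h2] := ker_enclosures R.
have [_ []] := entry_bounds _ _ _ _ _ h0 h1 h2 (krho_enclosure R).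
by move/conditions_solmx: GP => ->; rewrite !mxE.
Qed.

Lemma rho_ge1 : 1 <= rho.
Proof. by have := krho_enclosure R; lra. Qed.

Lemma solution_psd : psdmx G.
Proof.
have [g01 g02 g12 _] := solution_bounds; have [_ _ _ x3] := mom7_entries.
by apply: (psd_of_block _ _ _ Gsym Gdiag Gx x3 g01); lra.
Qed.

Lemma solution_rank : \rank G = 3%N.
Proof.
have [g01 g02 g12 _] := solution_bounds; have [_ _ _ x3] := mom7_entries.
by apply: (rank_of_block _ _ _ Gsym Gdiag Gx x3 g01); lra.
Qed.

Lemma G_d7_6 : G *m d7 R 6 = 0.
Proof. by rewrite d7_6 -scalemxAr Gx scaler0. Qed.

Lemma G_d7_7 : G *m d7 R 7 = 0.
Proof. by rewrite d7_last -scalemxAr Gx scaler0. Qed.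

Lemma d7_5_ge0 v : bform G (e 3) v <= 0 -> 0 <= bform G (d7 R 5) v.
Proof.
move=> v0; have t6 : 0 < t R 6 - 1 by rewrite subr_gt0 t_gt1.
rewrite -(pmulr_rge0 _ t6) bform_d7_5 // mulNr -mulrN.
by rewrite mulr_ge0 ?oppr_ge0 // ltW // t_gt0.
Qed.

Lemma d7_4_ge0 v : bform G (e 2) v + rho * bform G (e 3) v <= 0 ->
  0 <= bform G (d7 R 4) v.
Proof.
move=> v0; have t6 : 0 < t R 6 - 1 by rewrite subr_gt0 t_gt1.
have t5 : 0 < t R 5 - 1 by rewrite subr_gt0 t_gt1.
rewrite -(pmulr_rge0 _ t6) -(pmulr_rge0 _ t5) bform_d7_4 // mulNr -mulrN.
by rewrite mulr_ge0 ?oppr_ge0 // sqr_ge0.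
Qed.

(** With the relation [g02 + rho g03 = g12 + rho h], the two nontrivial values for
    [i = 4] are, up to a positive factor, [1 - g12] and
    [(1 - g12) + (rho - 1) (1 - h)]; for [i = 5] they are [g03 - h], which
    equals [(g12 - g02) / rho], and [1 - h]. *)
Lemma d7_diff_ge0 (i : 'I_8) (j : 'I_4) :
  0 <= bform G (d7 R i) (e (iota7 i) - e j).
Proof.
have [_ g02 g12 h] := solution_bounds; have r1 := rho_ge1.
have G1 := psd_entry_le1 G solution_psd Gdiag.
have d4 : 0 <= bform G (d7 R 4) (e 0 - e j).
  apply: d7_4_ge0; rewrite !bformDr !bformNr.
  rewrite (bform_e G i2 i0) (bform_e G i3 i0) (bform_e G i2 j) (bform_e G i3 j).
  move: Grel; rewrite (Gsw i0 i2) (Gsw i0 i3) => rel.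
  elim/ord4P: j; rewrite ?Gdiag ?(Gsw i0 i2) ?(Gsw i0 i3) ?(Gsw i1 i2)
    ?(Gsw i1 i3) ?(Gsw i2 i3).
  - by lra.
  - by lra.
  - by move: rel; rewrite G13; lra.
  - have := mulr_ge0 (_ : 0 <= rho - 1) (_ : 0 <= 1 - G i2 i3).
    by move: rel; rewrite G13; move=> rel /(_ ltac:(lra) ltac:(lra)); lra.
have e0 : 0 <= bform G (e 0) (e 0 - e j).
  rewrite bformDr bformNr (bform_e G i0 i0) (bform_e G i0 j) Gdiag.
  by rewrite subr_ge0 G1.
have low := d7_low_ge0 G _ d4 e0.
case: i => [[|[|[|[|[|[|[|[|//]]]]]]]] i8]; rewrite /iota7 /=.
1-5: exact: low.
- apply: d7_5_ge0; rewrite !bformDr !bformNr (bform_e G i3 i1) (bform_e G i3 j).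
  have rg : 0 <= rho * (G i0 i3 - G i1 i3) by move: Grel g02; lra.
  have {}rg : G i1 i3 <= G i0 i3.
    by rewrite -subr_ge0 -(pmulr_rge0 _ (lt_le_trans ltr01 r1)).
  elim/ord4P: j {d4 e0 low};
    rewrite ?Gdiag ?(Gsw i0 i3) ?(Gsw i1 i3) ?(Gsw i2 i3).
  - by lra.
  - by lra.
  - by rewrite G13; lra.
  - by rewrite G13; lra.
- by rewrite bform_kerl // G_d7_6.
- by rewrite bform_kerl // G_d7_7.
Qed.

Lemma d7_iota_ge0 (i : 'I_8) : 0 <= bform G (d7 R i) (e (iota7 i)).
Proof.
have [_ g02 g12 h] := solution_bounds; have r1 := rho_ge1.
have d4 : 0 <= bform G (d7 R 4) (e 0).
  apply: d7_4_ge0; rewrite (bform_e G i2 i0) (bform_e G i3 i0).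
  rewrite (Gsw i0 i2) (Gsw i0 i3).
  have := mulr_ge0 (_ : 0 <= rho) (_ : 0 <= - G i2 i3).
  move=> /(_ ltac:(lra) ltac:(lra)); move: Grel; rewrite G13; lra.
have e0 : 0 <= bform G (e 0) (e 0) by rewrite (bform_e G i0 i0) Gdiag ler01.
have low := d7_low_ge0 G _ d4 e0.
case: i => [[|[|[|[|[|[|[|[|//]]]]]]]] i8]; rewrite /iota7 /=.
1-5: exact: low.
- by apply: d7_5_ge0; rewrite (bform_e G i3 i1) (Gsw i1 i3) G13.
- by rewrite bform_kerl // G_d7_6.
- by rewrite bform_kerl // G_d7_7.
Qed.

Lemma solution_w7 : bform G (w7 R) (w7 R) = S7 R.
Proof.
have [_ _ d4 d5] := GP.
apply: sum_of_squares => //; last by rewrite bform_kerl // G_d7_7.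
move=> [|[|[|[|[|[|[|//]]]]]]] _; rewrite /fvec /iota7 /=.
1-4: by rewrite subrr bform_kerr // mulmx0.
- exact: d4.
- exact: d5.
- by rewrite bform_kerl // G_d7_6.
Qed.
End Solution.

End Conditions.

Theorem lemma5p1 (R : realType) :
  (exists! G : 'M[R]_4, G7_conditions G) /\
  (forall G : 'M[R]_4, G7_conditions G ->
     psdmx G /\ \rank G = 3%N /\
     (forall (i : 'I_8) (j : 'I_4),
        0 <= bform G (d7 R i) (evec R 4 (iota7 i) - evec R 4 j)) /\
     (forall i : 'I_8, 0 <= bform G (d7 R i) (evec R 4 (iota7 i))) /\
     bform G (w7 R) (w7 R) = S7 R /\
     G *m d7 R 6 = 0 /\ G *m d7 R 7 = 0).
Proof.
split.
  exists (solmx R); split; first exact/conditions_solmx.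
  by move=> G /conditions_solmx ->.
move=> G GP; split; first exact: solution_psd.
split; first exact: solution_rank.
split; first exact: d7_diff_ge0.
split; first exact: d7_iota_ge0.
split; first exact: solution_w7.
by split; [exact: G_d7_6|exact: G_d7_7].
Qed.
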